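(* Fix $W>0$ and consider the system $y_{t+1}=a\phi_b(y_t)+u_t+w_{t+1}$, $t\ge0$, with disturbances satisfying $\sup_{t\ge1}|w_t|\le W$. A point $p_0=(a_0,b_0)\in\mathbb R\times(0,\infty)$ is locally robustly stabilizable if and only if $$b_0<\frac{3\sqrt3}{2}.$$
   Context: For $b>0$ and $y\in\mathbb R$, $\phi_b(y)=\operatorname{sgn}(y)|y|^b$ (so $\phi_b(0)=0$). The state is $y_t\in\mathbb R$, the input is $u_t\in\mathbb R$, and the true parameter $p^\star=(a^\star,b^\star)\in\mathbb R\times(0,\infty)$ is unknown to the controller; trajectories are generated by $y_{t+1}=a^\star\phi_{b^\star}(y_t)+u_t+w_{t+1}$. A feedback law is a sequence $\mu=(\mu_t)_{t\ge0}$ of maps $\mu_t:\mathbb R^{t+1}\to\mathbb R$ (no regularity required) with $u_t=\mu_t(y_0,\ldots,y_t)$; it may depend on the prescribed parameter set and on $W$, but not on $p^\star$ or the disturbances. A nonempty set $\mathcal P\subset\mathbb R\times(0,\infty)$ is robustly stabilizable if there is a feedback law such that $\sup_{t\ge0}|y_t|<\infty$ for every $p^\star\in\mathcal P$, every $y_0\in\mathbb R$, and every disturbance sequence with $\sup_{t\ge1}|w_t|\le W$. A compact rectangle is a product of two compact intervals. A point $p_0\in\mathbb R\times(0,\infty)$ is locally robustly stabilizable if there is a compact rectangle $Q\subset\mathbb R\times(0,\infty)$ with $p_0\in\operatorname{int}Q$ that is robustly stabilizable. *)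

(* Defs.v *)
From mathcomp Require Import all_boot all_order all_algebra.
From mathcomp Require Import all_classical all_reals all_analysis.

Set Implicit Arguments.
Unset Strict Implicit.
Unset Printing Implicit Defensive.

Import Order.TTheory GRing.Theory Num.Theory.
Import numFieldNormedType.Exports.

Local Open Scope classical_set_scope.
Local Open Scope ring_scope.

Definition phi (R : realType) (b y : R) : R := Num.sg y * `|y| `^ b.

Definition param_space (R : realType) : set (R * R) :=
  [set p : R * R | 0 < p.2].

Definition feedback_law (R : realType) : Type :=
  forall t : nat, t.+1.-tuple R -> R.

Definition history (R : realType) (y : nat -> R) (t : nat) : t.+1.-tuple R :=
  [tuple y i | i < t.+1].

(* The trajectory starts from the arbitrary initial state y 0. *)
Definition closed_loop (R : realType) (mu : feedback_law R) (p : R * R)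
    (w y : nat -> R) : Prop :=
  forall t : nat,
    y t.+1 = p.1 * phi p.2 (y t) + mu t (history y t) + w t.+1.

(* Disturbances are indexed from 1; the value w 0 is never used. *)
Definition admissible_disturbance (R : realType) (W : R) (w : nat -> R) : Prop :=
  forall t : nat, (1 <= t)%N -> `|w t| <= W.

Definition robustly_stabilizable (R : realType) (W : R) (P : set (R * R)) : Prop :=
  [/\ P !=set0, P `<=` @param_space R &
    exists mu : feedback_law R,
      forall (p : R * R) (w y : nat -> R),
        P p -> admissible_disturbance W w -> closed_loop mu p w y ->
        has_ubound (range (fun t : nat => `|y t|))].

Definition compact_rectangle (R : realType) (Q : set (R * R)) : Prop :=
  exists a1 a2 b1 b2 : R,
    [/\ a1 <= a2, b1 <= b2 & Q = `[a1, a2]%classic `*` `[b1, b2]%classic].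

Definition locally_robustly_stabilizable (R : realType) (W : R) (p0 : R * R) :
    Prop :=
  exists Q : set (R * R),
    [/\ compact_rectangle Q, Q `<=` @param_space R, interior Q p0 &
        robustly_stabilizable W Q].

(* Main.v *)
Require Import Defs.
From mathcomp Require Import all_boot all_order all_algebra.
From mathcomp Require Import all_classical all_reals all_analysis.
From mathcomp Require Import ring lra.

Set Implicit Arguments.
Unset Strict Implicit.
Unset Printing Implicit Defensive.

Import Order.TTheory GRing.Theory Num.Theory.
Import numFieldNormedType.Exports.

Local Open Scope classical_set_scope.
Local Open Scope ring_scope.

(** Write x_t = |y_t|, L_t = ln x_t, and call l(L) = alpha + b L, with
alpha = ln |a|, the log-response: |a phi_b(y)| = exp (l(ln |y|)).  A sample of
the response at x determines l(ln x) up to an error of order W / x^b.  Two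
samples, at the last two scales below the current one, determine the affine
function l; extrapolating it to L_t multiplies the older error, of order
x_{t-2}^{-b}, by a ratio of log-distances.  A prediction at x_t is thus known up
to about (x_t / x_{t-2})^b and not better, so that the best that the controller
can enforce and the worst that the disturbance can achieve are both governed by

  L_{t+1} = b (L_t - L_{t-2}),

whose characteristic equation z^3 - b z^2 + b = 0 has a root z > 1 exactly when
b is at least the minimum 3 sqrt 3 / 2 of z^3 / (z^2 - 1), attained at
z = sqrt 3.

Below the critical exponent, the controller cancels the response of any
parameter of the rectangle that is compatible with all past observations.  If
the state were unbounded, the times at which it first exceeds twice the
previously selected value would give scales Z_k with
Z_{k+3} <= C (Z_{k+2} / Z_k)^beta for some subcritical beta
([extrapolation], [set_membership_bounded]), which
[subcritical_recursion_absurd] excludes.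

At or above the critical exponent, every neighbourhood of the point contains
parameters with a strictly larger b.  The adversary maintains a current
parameter and, at time t, tilts its log-response by plus or minus d_t around the
pivot L_{t-1}.  The sign is chosen after the input is known, so that the input
cannot cancel both responses, and d_t is as large as the precision of the
observation at x_{t-2} allows.  The scales then grow at least by the factor
sqrt 3 at each step.  The parameters converge, and the limit parameter explains
the whole trajectory with disturbances bounded by W ([adversary_wins]). *)

(** * The limiting recursion *)

Lemma exists_nat_gt (R : archiRealFieldType) (x : R) : exists n : nat, x < n%:R.
Proof.
exists (Num.bound `|x|).
exact: le_lt_trans (ler_norm _) (archi_boundP (normr_ge0 _)).
Qed.

(** With c = 3 sqrt 3 / 2 one has
r^3 - c r^2 + c = (r - sqrt 3)^2 (r + sqrt 3 / 2), so that c is the threshold at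
which r = b (1 - r^-2) acquires a positive solution. *)
Lemma critical_exponent_bound (R : rcfType) (r : R) : 0 < r ->
  3 * Num.sqrt 3 / 2 * (1 - r ^- 2) <= r.
Proof.
move=> r_gt0; have s2 : Num.sqrt 3 ^+ 2 = 3 :> R by rewrite sqr_sqrtr.
have s_ge0 := sqrtr_ge0 (3 : R); move: (Num.sqrt 3) s2 s_ge0 => s s2 s_ge0.
rewrite -subr_ge0.
have -> : r - 3 * s / 2 * (1 - r ^- 2) = (r - s) ^+ 2 * (r + s / 2) / r ^+ 2.
  have r_neq0 : r != 0 by rewrite gt_eqF.
  have s3 : s * s * s = 3 * s by rewrite -s2; ring.
  apply: (mulIf (expf_neq0 2 r_neq0)).
  rewrite mulfVK ?expf_neq0//.
  have -> : (r - 3 * s / 2 * (1 - r ^- 2)) * r ^+ 2 =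
      r ^+ 3 - 3 * s / 2 * r ^+ 2 + 3 * s / 2 by field.
  have -> : (r - s) ^+ 2 * (r + s / 2) =
    r ^+ 3 - 3 * s / 2 * r ^+ 2 + s * s * s / 2 by field.
  by rewrite s3.
rewrite divr_ge0 ?sqr_ge0// mulr_ge0 ?sqr_ge0//; lra.
Qed.

(** If all ratios L_{k+1} / L_k are eventually at most r, then
L_k >= r^-2 L_{k+2}, and the recursion bounds the next ratio by
beta (1 - r^-2) + o(1), hence by theta r + o(1) with theta = beta / c < 1 by
[critical_exponent_bound].  Repeating this brings the ratios below 1, although L
increases. *)
Lemma subcritical_recursion_absurd (R : realType) (L : nat -> R) (c beta C : R) :
  0 < c -> 0 < beta -> beta < 3 * Num.sqrt 3 / 2 -> 0 < L 0%N ->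
  (forall k, L k + c <= L k.+1) ->
  (forall k, L k.+3 <= beta * (L k.+2 - L k) + C) -> False.
Proof.
move=> c_gt0 beta_gt0 beta_lt L0 Lstep Lrec.
have Lgt0 k : 0 < L k by elim: k => // k IH; have := Lstep k; lra.
have Lincr k : L k < L k.+1 by have := Lstep k; lra.
have Llarge M : exists N, forall k, (N <= k)%N -> M <= L k.
  have Llin k : k%:R * c <= L k.
    elim: k => [|k IH]; first by rewrite mul0r ltW.
    by rewrite -natr1; have := Lstep k; lra.
  have [N MN] := exists_nat_gt (M / c).
  exists N => k Nk; apply: le_trans (Llin k).
  rewrite -ler_pdivrMr//; apply: ltW (lt_le_trans MN _).
  by rewrite ler_nat.
set crit := 3 * Num.sqrt 3 / 2 in beta_lt *.
have crit_gt0 : 0 < crit by lra.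
set theta := beta / crit.
have theta_lt1 : theta < 1 by rewrite ltr_pdivrMr// mul1r.
have theta_gt0 : 0 < theta by rewrite divr_gt0.
set eps := (1 - theta) / 2.
have eps_gt0 : 0 < eps by rewrite /eps; lra.
have Lbig d : 0 < d -> exists N, forall k, (N <= k)%N -> C <= d * L k.
  move=> d_gt0; have [N HN] := Llarge (C / d); exists N => k /HN.
  by rewrite ler_pdivrMr// mulrC.
have ratio m : exists N, forall k, (N <= k)%N ->
    L k.+1 <= (beta + 1 - m%:R * eps) * L k.
  elim: m => [|m [N IH]].
    have [N HN] := Lbig 1 ltr01; exists N.+2 => -[|[|k]]// Nk.
    have := Lrec k; have := HN _ (ltnW (ltnW Nk)).
    have := Lgt0 k.
    have : 0 <= beta * L k by rewrite mulr_ge0 ?ltW.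
    by rewrite mul0r; lra.
  set r := beta + 1 - m%:R * eps in IH.
  have r_ge1 : 1 <= r.
    have := IH N (leqnn _); have := Lincr N => h1 h2.
    by rewrite -(ler_pM2r (Lgt0 N)); lra.
  have r_gt0 : 0 < r by lra.
  have [N' HN'] := Lbig _ eps_gt0.
  exists (maxn N N').+2 => -[|[|k]]//; rewrite !ltnS geq_max => /andP[Nk N'k].
  have Lk : r ^- 2 * L k.+2 <= L k.
    rewrite mulrC ler_pdivrMr ?exprn_gt0//.
    have h1 := IH k Nk; have h2 := IH k.+1 (leqW Nk).
    have h3 : r * L k.+1 <= r * (r * L k) by rewrite ler_pM2l.
    apply: le_trans h2 (le_trans h3 _).
    by rewrite mulrA -expr2 mulrC.
  have step : beta * (L k.+2 - L k) <= theta * r * L k.+2.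
    apply: (@le_trans _ _ (beta * ((1 - r ^- 2) * L k.+2))).
      by rewrite ler_pM2l//; lra.
    rewrite mulrA ler_pM2r//.
    have -> : beta = theta * crit by rewrite mulfVK// gt_eqF.
    by rewrite -mulrA ler_pM2l// critical_exponent_bound.
  have hC := HN' k.+2 (leqW (leqW N'k)).
  have : theta * r <= r - 2 * eps.
    have : 0 <= (1 - theta) * (r - 1) by rewrite mulr_ge0//; lra.
    by rewrite /eps; lra.
  rewrite -(ler_pM2r (Lgt0 k.+2)) -natr1 => h.
  have := Lrec k; rewrite (_ : beta + 1 - _ = r - eps); last by rewrite /r; ring.
  by move: h step hC; clearbody r eps theta; lra.
have [m Hm] := exists_nat_gt (beta / eps).
have [N /(_ N (leqnn _)) HN] := ratio m.
have := Lincr N.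
rewrite ltr_pdivrMr// in Hm.
suff : (beta + 1 - m%:R * eps) * L N <= L N by lra.
by rewrite ger_pMl//; lra.
Qed.

(** * Extrapolation of a power law from two samples *)

Lemma ln_sub_le (R : realType) (u v : R) : 0 < u -> 0 < v ->
  ln u - ln v <= (u - v) / v.
Proof.
move=> u0 v0; have -> : (u - v) / v = u / v - 1 by rewrite mulrBl divff ?gt_eqF.
rewrite -ln_div ?posrE//.
rewrite [X in ln X](_ : _ = 1 + (u / v - 1)); last by ring.
by apply: le_ln1Dx; have := divr_gt0 u0 v0; lra.
Qed.

Lemma ln_dist_le (R : realType) (d u v : R) : 0 < u -> `|u - v| <= d ->
  2 * d <= u -> `|ln u - ln v| <= 2 * d / u.
Proof.
move=> u0 uvd du; have [uvd1 uvd2] : u - v <= d /\ v - u <= d.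
  by move: uvd; rewrite ler_norml => /andP[]; lra.
have d0 : 0 <= d by exact: le_trans uvd.
have v0 : 0 < v by lra.
rewrite ler_norml; apply/andP; split.
  rewrite lerNl opprB; apply: le_trans (ln_sub_le v0 u0) _.
  by rewrite ler_pM2r ?invr_gt0//; lra.
apply: le_trans (ln_sub_le u0 v0) _.
rewrite ler_pdivrMr// mulrAC ler_pdivlMr//.
apply: (@le_trans _ _ (d * u)); first by rewrite ler_pM2r.
by rewrite [2 * d]mulrC -mulrA ler_wpM2l//; lra.
Qed.

Lemma dist_le_ln (R : realType) (M u v : R) : 0 < u -> 0 < v -> u <= M ->
  v <= M -> `|u - v| <= `|ln u - ln v| * M.
Proof.
wlog : u v / v <= u => [hwlog u0 v0 uM vM|vu u0 v0 uM vM].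
  have [vu|/ltW uv] := leP v u; first exact: hwlog.
  by rewrite distrC (distrC (ln u)); exact: hwlog.
have ln_ge : 0 <= ln u - ln v by rewrite subr_ge0 ler_ln ?posrE.
rewrite !ger0_norm ?subr_ge0//; last by rewrite -subr_ge0.
apply: le_trans (ler_wpM2l ln_ge uM).
rewrite -ler_pdivrMr//; have := ln_sub_le v0 u0.
by rewrite -[v - u]opprB mulNr; lra.
Qed.

Lemma ln_le_powR (R : realType) (e v : R) : 0 < e -> 0 < v ->
  ln v <= v `^ e / e.
Proof.
by move=> e0 v0; rewrite ler_pdivlMr// mulrC -ln_powR ltW// ln_sublinear// powR_gt0.
Qed.

(** The difference q of the two log-responses is affine in ln x, and it is at
most e = 4 W / (a P^b) at P and at Z.  As ln Z - ln P >= ln 2, its slope is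
O(e), so that |q(x)| <= e (1 + O(|ln (x / P)|)).  Multiplying by the size of the
responses at x, which is O(a P^b (X / P)^bp), the unknown factor a P^b cancels,
and the logarithm is absorbed by the exponent eps.  Bounding the difference by q
times the larger of the two responses, rather than by a linearization at the
true one, makes the estimate valid even when q(x) is large. *)
Lemma extrapolation_pos (R : realType) (W bm bp eps a b : R) :
  0 < W -> 0 < bm -> 0 < eps -> 0 < a -> bm <= b <= bp ->
  exists K C, [/\ 0 < K, 0 < C & forall a' b' P Z X x : R,
    bm <= b' <= bp -> K <= P -> 2 * P <= Z -> P <= X -> 0 <= x <= X ->
    `|a * P `^ b - a' * P `^ b'| <= 2 * W ->
    `|a * Z `^ b - a' * Z `^ b'| <= 2 * W ->
    `|a * x `^ b - a' * x `^ b'| <= C * (X / P) `^ (bp + eps)].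
Proof.
move=> W0 bm0 eps0 a0 /andP[bmb bbp].
have b0 : 0 < b by lra.
have ln2 : 0 < ln (2 : R) by rewrite ln_gt0//; lra.
set K := Num.max 1 ((4 * W / a) `^ b^-1).
have [C CE] : exists C, C = 6 * W * (1 + 2 / ln 2 * (eps^-1 + bm^-1)).
  by eexists.
have K0 : 0 < K by rewrite lt_max ltr01.
have C0 : 0 < C.
  rewrite CE mulr_gt0 ?mulr_gt0 ?addr_gt0 ?mulr_gt0 ?divr_gt0 ?addr_gt0
    ?invr_gt0//; lra.
exists K, C; split=> // a' b' P Z X x /andP[bmb' b'bp] KP PZ PX /andP[x0 xX] hP hZ.
have P0 : 0 < P by lra.
have Z0 : 0 < Z by lra.
have X0 : 0 < X by lra.
have b'0 : 0 < b' by lra.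
have XP1 : 1 <= X / P by rewrite ler_pdivlMr// mul1r.
have XPe_ge1 : 1 <= (X / P) `^ eps.
  by have := ler_powR XP1 (ltW eps0); rewrite powRr0.
have XPbe_ge1 : 1 <= (X / P) `^ (bp + eps).
  have : 0 <= bp + eps by lra.
  by move=> /(ler_powR XP1); rewrite powRr0.
have [->|x_neq0] := eqVneq x 0.
  rewrite !powR0 ?gt_eqF// !mulr0 subrr normr0.
  by rewrite mulr_ge0 ?powR_ge0// ltW.
have {x_neq0}x0 : 0 < x by rewrite lt_def x_neq0.
(* P >= K means that the response at P dominates the noise, so that a' has the
   sign of a and ratios of responses at P and Z can be measured by logarithms *)
have aPW : 2 * (2 * W) <= a * P `^ b.
  have : (4 * W / a) `^ b^-1 <= P.
    by apply: le_trans KP; rewrite le_max lexx orbT.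
  move=> /(@ge0_ler_powR R b (ltW b0)).
  rewrite !nnegrE powR_ge0 ltW// => /(_ isT isT).
  rewrite -powRrM mulVf ?gt_eqF// powRr1; last by rewrite divr_ge0//; lra.
  by rewrite ler_pdivrMr//; lra.
clearbody K.
have bp0 : 0 <= bp by exact: le_trans (ltW b0) bbp.
have XP0 : 0 <= X / P by exact: le_trans XP1.
have Pb0 : 0 < P `^ b by rewrite powR_gt0.
have aP0 : 0 < a * P `^ b by rewrite mulr_gt0.
have a'P0 : 0 < a' * P `^ b'.
  by move: hP; rewrite ler_norml => /andP[]; lra.
have a'P_le : a' * P `^ b' <= 3 / 2 * (a * P `^ b).
  by move: hP; rewrite ler_norml => /andP[]; lra.
have a'0 : 0 < a' by rewrite -(pmulr_lgt0 _ (powR_gt0 b' P0)).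
pose q z := ln (a * z `^ b) - ln (a' * z `^ b').
have qE z : 0 < z -> q z = q P + (b - b') * (ln z - ln P).
  move=> z0; rewrite /q !lnM ?posrE ?powR_gt0// !ln_powR; ring.
have [e eE] : exists e, e = 2 * (2 * W) / (a * P `^ b) by eexists.
have W4 : 0 < 2 * (2 * W) by rewrite !mulr_gt0.
have e0 : 0 < e by rewrite eE divr_gt0.
have qP : `|q P| <= e by rewrite eE; exact: ln_dist_le.
have aPZ : a * P `^ b <= a * Z `^ b.
  rewrite ler_pM2l// ge0_ler_powR ?nnegrE ?ltW//.
  by apply: lt_le_trans PZ; rewrite ltr_pMl// ltr1n.
have aZ0 : 0 < a * Z `^ b by exact: lt_le_trans aPZ.
have qZ : `|q Z| <= e.
  apply: le_trans (ln_dist_le aZ0 hZ (le_trans aPW aPZ)) _.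
  by rewrite eE ler_pM2l ?lef_pV2 ?posrE.
have db : `|b - b'| * ln 2 <= 2 * e.
  apply: (@le_trans _ _ `|(b - b') * (ln Z - ln P)|).
    rewrite normrM ler_wpM2l//; apply: le_trans (ler_norm _).
    by rewrite -ln_div ?posrE// ler_ln ?posrE ?divr_gt0// ler_pdivlMr.
  have -> : (b - b') * (ln Z - ln P) = q Z - q P by rewrite (qE Z)//; ring.
  by apply: le_trans (ler_normB _ _) _; rewrite mulr_natl mulr2n lerD.
have qx : `|q x| <= e * (1 + 2 / ln 2 * `|ln (x / P)|).
  rewrite qE// ln_div ?posrE//; apply: le_trans (ler_normD _ _) _.
  rewrite [leRHS]mulrDr mulr1 lerD// normrM.
  by rewrite [leRHS]mulrA ler_wpM2r// mulrA ler_pdivlMr// [e * 2]mulrC.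
have bound M : (x / P) `^ b <= M -> (x / P) `^ b' <= M ->
    `|a * x `^ b - a' * x `^ b'| <=
    6 * W * ((1 + 2 / ln 2 * `|ln (x / P)|) * M).
  move=> Mb Mb'.
  have M0 : 0 <= M by apply: le_trans Mb; rewrite powR_ge0.
  have -> : 6 * W * ((1 + 2 / ln 2 * `|ln (x / P)|) * M) =
      e * (1 + 2 / ln 2 * `|ln (x / P)|) * (3 / 2 * (a * P `^ b) * M).
    by rewrite eE; field; rewrite !gt_eqF.
  have xE z : x `^ z = P `^ z * (x / P) `^ z.
    by rewrite -powRM ?divr_ge0 ?ltW// mulrCA divff ?mulr1// gt_eqF.
  apply: le_trans (dist_le_ln _ _ _ _) (ler_wpM2r _ qx);
    rewrite ?mulr_gt0 ?powR_gt0//; last by rewrite !mulr_ge0// ltW.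
  - rewrite (xE b) mulrA; apply: (@le_trans _ _ (a * P `^ b * M)).
      by rewrite ler_wpM2l// ltW.
    by rewrite ler_wpM2r// ler_peMl ?(ltW aP0)// ler_pdivlMr// mul1r ler_nat.
  - rewrite (xE b') mulrA; apply: (@le_trans _ _ (a' * P `^ b' * M)).
      by rewrite ler_wpM2l// ltW.
    by rewrite ler_wpM2r.
have epsV : 0 < eps^-1 by rewrite invr_gt0.
have bmV : 0 < bm^-1 by rewrite invr_gt0.
have c2 : 0 < 2 / ln (2 : R) by rewrite divr_gt0.
have [Px|xP] := leP P x.
  have xP1 : 1 <= x / P by rewrite ler_pdivlMr// mul1r.
  have xXP : x / P <= X / P by rewrite ler_pM2r ?invr_gt0.
  have Hb z : 0 <= z -> z <= bp -> (x / P) `^ z <= (X / P) `^ bp.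
    move=> z0 zb; apply: le_trans (ler_powR XP1 zb).
    by apply: ge0_ler_powR; rewrite ?nnegrE// (le_trans _ xP1).
  apply: le_trans (bound _ (Hb b (ltW b0) bbp) (Hb b' (ltW b'0) b'bp)) _.
  rewrite CE -[leRHS]mulrA ler_pM2l ?mulr_gt0//.
  rewrite [bp + eps]addrC powRD; last by rewrite gt_eqF ?ltr_wpDr.
  rewrite mulrA ler_wpM2r ?powR_ge0//.
  rewrite ger0_norm ?ln_ge0 // [leRHS]mulrDl mul1r lerD//.
  rewrite -[leRHS]mulrA ler_pM2l//.
  apply: (@le_trans _ _ (ln (X / P))).
    by rewrite ler_ln ?posrE// ?divr_gt0.
  apply: le_trans (ln_le_powR eps0 _) _; first by rewrite divr_gt0.
  by rewrite mulrC ler_wpM2r ?powR_ge0// lerDl ltW.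
(* below the samples, (x / P)^bm compensates the growth of |ln (x / P)| *)
have Hb z : bm <= z -> (x / P) `^ z <= (x / P) `^ bm.
  move=> zb; apply: ger_powR => //.
  by rewrite divr_gt0//= ler_pdivrMr// mul1r ltW.
apply: le_trans (bound _ (Hb b _) (Hb b' _)) _ => //.
apply: (@le_trans _ _ C); last by rewrite ler_pMr.
rewrite CE ler_pM2l ?mulr_gt0//.
have ln_xP : `|ln (x / P)| * (x / P) `^ bm <= bm^-1.
  have Px0 : 0 < P / x by rewrite divr_gt0.
  have -> : x / P = (P / x)^-1 by rewrite invf_div.
  rewrite lnV ?posrE// normrN ger0_norm; last first.
    by rewrite ln_ge0// ler_pdivlMr// mul1r ltW.
  rewrite -(powR_inv1 (ltW Px0)) -powRrM mulN1r powRN.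
  rewrite ler_pdivrMr ?powR_gt0// [leRHS]mulrC.
  exact: ln_le_powR.
have xP_le1 : (x / P) `^ bm <= 1.
  have h : 0 < x / P <= 1 by rewrite divr_gt0//= ler_pdivrMr// mul1r ltW.
  by have := ger_powR h (ltW bm0); rewrite powRr0.
rewrite [leLHS]mulrDl mul1r lerD// -[leLHS]mulrA ler_pM2l//.
by apply: le_trans ln_xP _; rewrite lerDr ltW.
Qed.

(** When a = 0 the response carries no information on b, but then the sample at
P alone bounds the estimated response by 2 W (X / P)^bp. *)
Lemma extrapolation (R : realType) (W bm bp eps a b : R) :
  0 < W -> 0 < bm -> 0 < eps -> bm <= b <= bp ->
  exists K C, [/\ 0 < K, 0 < C & forall a' b' P Z X x : R,
    bm <= b' <= bp -> K <= P -> 2 * P <= Z -> P <= X -> 0 <= x <= X ->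
    `|a * P `^ b - a' * P `^ b'| <= 2 * W ->
    `|a * Z `^ b - a' * Z `^ b'| <= 2 * W ->
    `|a * x `^ b - a' * x `^ b'| <= C * (X / P) `^ (bp + eps)].
Proof.
move=> W0 bm0 eps0 bb; have [a0|a0|<-] := ltgtP 0 a.
- exact: extrapolation_pos.
- have Na0 : 0 < - a by rewrite oppr_gt0.
  have [K [C [K0 C0 H]]] := extrapolation_pos W0 bm0 eps0 Na0 bb.
  exists K, C; split=> // a' b' P Z X x b'b KP PZ PX xX hP hZ.
  have swap z : `|a * z `^ b - a' * z `^ b'| = `|- a * z `^ b - - a' * z `^ b'|.
    by rewrite !mulNr -opprD normrN.
  rewrite swap; apply: (H _ _ P Z) => //; by rewrite -swap.
- exists 1, (2 * W); split; [exact: ltr01|exact: mulr_gt0|].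
  move=> a' b' P Z X x /andP[bmb' b'bp] KP _ PX /andP[x0 xX] + _.
  rewrite !mul0r !sub0r !normrN !normrM !(ger0_norm (powR_ge0 _ _)) => hP.
  have P0 : 0 < P by lra.
  have XP0 : 0 <= X / P by rewrite divr_ge0//; lra.
  apply: (@le_trans _ _ (`|a'| * X `^ b')).
    by rewrite ler_wpM2l// ge0_ler_powR ?nnegrE//; lra.
  have -> : X `^ b' = P `^ b' * (X / P) `^ b'.
    by rewrite -powRM ?(ltW P0)// mulrCA divff ?mulr1// gt_eqF.
  rewrite mulrA.
  apply: ler_pM => //; rewrite ?mulr_ge0 ?powR_ge0//.
  by apply: ler_powR; [rewrite ler_pdivlMr// mul1r|lra].
Qed.

(** * Subcritical exponents: a stabilizing law *)

(** Here x_t stands for |y_t| and (a' t, b' t) for the estimate used at time t,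
which agrees with the true parameter up to 2 W at all earlier states.  The
consecutive states of an unbounded trajectory need not be comparable, so the
recursion is derived for the times tau_k at which x first exceeds 2 Z_{k-1},
with Z_k the value reached: the state that produces Z_{k+3} is at most
2 Z_{k+2}, and at that time the well separated samples Z_k and Z_{k+1} are
known. *)
Lemma set_membership_bounded (R : realType) (W bm bp a b : R)
    (a' b' x : nat -> R) :
  0 < W -> 0 < bm -> bp < 3 * Num.sqrt 3 / 2 -> bm <= b <= bp ->
  (forall t, bm <= b' t <= bp) -> (forall t, 0 <= x t) ->
  (forall t i, (i < t)%N -> `|a * x i `^ b - a' t * x i `^ b' t| <= 2 * W) ->
  (forall t, x t.+1 <= `|a * x t `^ b - a' t * x t `^ b' t| + W) ->
  exists M, forall t, x t <= M.
Proof.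
move=> W0 bm0 bp_lt bb bb' x0 fit step; apply: contrapT => nbnd.
have unb M : exists t, M < x t.
  apply: contrapT => /forallNP hM; apply: nbnd; exists M => t.
  by rewrite leNgt; apply/negP/hM.
have [eps [eps0 beta_lt]] : exists eps, 0 < eps /\ bp + eps < 3 * Num.sqrt 3 / 2.
  by exists ((3 * Num.sqrt 3 / 2 - bp) / 2); split; lra.
have [K [C [K0 C0 extra]]] := extrapolation a W0 bm0 eps0 bb.
pose first M := ex_minn (unb M).
have firstP M : M < x (first M) by rewrite /first; case: ex_minnP.
have before_first M s : (s < first M)%N -> x s <= M.
  rewrite /first; case: ex_minnP => t _ tmin st.
  by rewrite leNgt; apply: contraL st => /tmin; rewrite -leqNgt.
pose tau := fix tau k := if k is j.+1 then first (2 * x (tau j))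
  else first (Num.max K 1).
pose Z k := x (tau k).
have Z0 : Num.max K 1 < Z 0%N by exact: firstP.
have Zstep k : 2 * Z k < Z k.+1 by exact: firstP.
have Zgt k : Num.max K 1 < Z k.
  have : 0 < Num.max K 1 by rewrite lt_max K0.
  by elim: k => // k IH; have := Zstep k; lra.
have ZK k : K <= Z k by have := Zgt k; rewrite gt_max => /andP[/ltW].
have Zgt1 k : 1 < Z k by have := Zgt k; rewrite gt_max => /andP[].
have Zpos k : 0 < Z k by exact: lt_trans ltr01 (Zgt1 k).
have tau_lt k : (tau k < tau k.+1)%N.
  rewrite ltnNge; apply/negP; rewrite leq_eqVlt => /orP[/eqP tauE|tau_lt].
    by have := Zstep k; rewrite /Z tauE; have := Zpos k; rewrite /Z; lra.
  have : x (tau k.+1) <= Z k.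
    case: k tau_lt => [|k] /before_first xle; apply: le_trans xle (ltW _).
      exact: Z0.
    exact: Zstep.
  by have := Zstep k; have := Zpos k; rewrite /Z; lra.
have Zrec k : Z k.+3 <= (C + W) * (2 * Z k.+2 / Z k) `^ (bp + eps).
  have [s tauE] : exists s, tau k.+3 = s.+1.
    by exists (tau k.+3).-1; rewrite prednK// (leq_trans _ (tau_lt k.+2)).
  have s_ge : (tau k.+2 <= s)%N by rewrite -ltnS -tauE.
  have xs : x s <= 2 * Z k.+2 by apply: (@before_first); rewrite -/(tau k.+3) tauE.
  have P1 : (tau k.+1 < s)%N by exact: leq_trans s_ge.
  have P0 : (tau k < s)%N by exact: ltn_trans (tau_lt k) P1.
  have Z12 := Zstep k; have Z23 := Zstep k.+1.
  have ratio : Z k <= 2 * Z k.+2 by have := Zpos k; lra.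
  have xbnd : 0 <= x s <= 2 * Z k.+2 by rewrite x0.
  have := extra (a' s) (b' s) (Z k) (Z k.+1) (2 * Z k.+2) (x s) (bb' s) (ZK k)
    (ltW Z12) ratio xbnd (fit s _ P0) (fit s _ P1).
  have pow1 : 1 <= (2 * Z k.+2 / Z k) `^ (bp + eps).
    have r1 : 1 <= 2 * Z k.+2 / Z k by rewrite ler_pdivlMr// mul1r.
    have := @ler_powR _ _ r1 0 (bp + eps); rewrite powRr0; apply.
    by move/andP: bb => [h1 h2]; lra.
  move=> hx; rewrite {1}/Z tauE; apply: le_trans (step s) _.
  by rewrite mulrDl lerD// ler_peMr// ltW.
have CW : 0 < C + W by rewrite addr_gt0.
have bpe : 0 < bp + eps by move/andP: bb => [h1 h2]; lra.
apply: (@subcritical_recursion_absurd R (fun k => ln (Z k)) (ln 2) (bp + eps)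
  (ln (C + W) + (bp + eps) * ln 2)) => //=.
- by rewrite ln_gt0// ltr1n.
- by rewrite ln_gt0.
- by move=> k; rewrite addrC -lnM ?posrE// ler_ln ?posrE ?mulr_gt0// ltW.
- move=> k; have := Zrec k; rewrite -ler_ln ?posrE ?mulr_gt0 ?powR_gt0//;
    last by rewrite divr_gt0// mulr_gt0.
  rewrite lnM ?posrE ?powR_gt0//; last by rewrite divr_gt0// mulr_gt0.
  rewrite ln_powR ln_div ?posrE ?mulr_gt0// lnM ?posrE//.
  by move=> h; apply: le_trans h _; rewrite le_eqVlt; apply/orP; left; apply/eqP; ring.
Qed.

(** Since phi_b is odd, errors of prediction depend on |y| only. *)
Lemma phi_dist (R : realType) (a b a' b' y : R) : 0 < b -> 0 < b' ->
  `|a * phi b y - a' * phi b' y| = `|a * `|y| `^ b - a' * `|y| `^ b'|.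
Proof.
move=> b0 b'0; have [->|y0] := eqVneq y 0.
  by rewrite /phi sgr0 !mul0r normr0 !powR0 ?gt_eqF// !mulr0.
rewrite /phi mulrCA [a' * _]mulrCA -mulrBr normrM.
by rewrite normr_sg y0 mul1r.
Qed.

Definition consistent (R : realType) (Q : set (R * R)) (W : R) (y u : nat -> R)
    (t : nat) : set (R * R) :=
  [set p | Q p /\
    forall i, (i < t)%N -> `|y i.+1 - u i - p.1 * phi p.2 (y i)| <= W].

Definition estimate (R : realType) (Q : set (R * R)) (W : R) (y u : nat -> R)
    (t : nat) : R * R := xget (0, 0) (consistent Q W y u t).

(** A feedback law sees the states only, so that the past inputs, which the test
of consistency involves, are recomputed from them: this is the sequence of
inputs before time t, extended by 0. *)
Fixpoint ce_inputs (R : realType) (Q : set (R * R)) (W : R) (y : nat -> R)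
    (t : nat) : nat -> R :=
  if t is s.+1 then
    let u := ce_inputs Q W y s in
    let p := estimate Q W y u s in
    fun i => if i == s then - (p.1 * phi p.2 (y s)) else u i
  else fun=> 0.

Definition ce_law (R : realType) (Q : set (R * R)) (W : R) : feedback_law R :=
  fun t h => ce_inputs Q W (fun i => nth 0 h i) t.+1 t.

Lemma ce_inputs_stable (R : realType) (Q : set (R * R)) (W : R) (y : nat -> R)
    (i t : nat) : (i < t)%N -> ce_inputs Q W y t i = ce_inputs Q W y i.+1 i.
Proof.
elim: t => // t IH; rewrite ltnS leq_eqVlt => /orP[/eqP -> //|it].
by rewrite [LHS]/= (ltn_eqF it) IH.
Qed.

Lemma ce_inputs_causal (R : realType) (Q : set (R * R)) (W : R)
    (y z : nat -> R) (t : nat) : (forall i, (i < t)%N -> y i = z i) ->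
  ce_inputs Q W y t = ce_inputs Q W z t.
Proof.
elim: t => //= t IH yz; rewrite IH; last by move=> i it; apply: yz; exact: ltnW.
have -> : estimate Q W y (ce_inputs Q W z t) t =
    estimate Q W z (ce_inputs Q W z t) t.
  rewrite /estimate; congr xget; apply/seteqP; split=> p [Qp fit]; split=> // i it;
    have := fit i it; by rewrite !yz// ltnS// ltnW.
by rewrite yz.
Qed.

Lemma nth_history (R : realType) (y : nat -> R) (t i : nat) : (i <= t)%N ->
  nth 0 (history y t) i = y i.
Proof.
by rewrite -ltnS => it; rewrite -(tnth_nth _ _ (Ordinal it)) tnth_mktuple.
Qed.

(** The true parameter is always consistent, so that an estimate exists and
differs from it by at most 2 W at every past state. *)
Lemma subcritical_rectangle_stabilizable (R : realType) (W a1 a2 b1 b2 : R) :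
  0 < W -> a1 <= a2 -> b1 <= b2 -> 0 < b1 -> b2 < 3 * Num.sqrt 3 / 2 ->
  robustly_stabilizable W (`[a1, a2]%classic `*` `[b1, b2]%classic).
Proof.
move=> W0 a12 b12 b1_gt0 b2_lt; set Q := _ `*` _.
have Qb p : Q p -> b1 <= p.2 <= b2 by case=> _ /=; rewrite in_itv.
split.
- by exists (a1, b1); split; rewrite /= in_itv/= lexx.
- by move=> p /Qb/andP[b1p _]; exact: lt_le_trans b1p.
exists (ce_law Q W) => p w y Qp adm loop.
pose u t := ce_inputs Q W y t.+1 t.
have lawE t : ce_law Q W (history y t) = u t.
  rewrite /ce_law /u (@ce_inputs_causal _ _ _ _ y)// => i it.
  by rewrite nth_history.
pose q t := estimate Q W y (ce_inputs Q W y t) t.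
have uE t : u t = - ((q t).1 * phi (q t).2 (y t)) by rewrite /u /= eqxx.
have pfit t : consistent Q W y (ce_inputs Q W y t) t p.
  split=> // i it; rewrite ce_inputs_stable// -/(u i) loop lawE.
  have -> : p.1 * phi p.2 (y i) + u i + w i.+1 - u i - p.1 * phi p.2 (y i) = w i.+1.
    by ring.
  exact: adm.
have qfit t : consistent Q W y (ce_inputs Q W y t) t (q t).
  by rewrite /q /estimate; exact: xgetPex (ex_intro _ p (pfit t)).
have Qq t : Q (q t) by case: (qfit t).
have pos r : Q r -> 0 < r.2 by move=> /Qb/andP[h _]; exact: lt_le_trans h.
have [M HM] : exists M, forall t, `|y t| <= M.
  apply: (@set_membership_bounded R W b1 b2 p.1 p.2 (fun t => (q t).1)
    (fun t => (q t).2) (fun t => `|y t|)) => //; first exact: Qb.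
  - by move=> t; exact: Qb.
  - move=> t i it; rewrite -phi_dist; [|exact: pos|exact: pos].
    have [_ /(_ i it) h1] := pfit t; have [_ /(_ i it) h2] := qfit t.
    have -> : p.1 * phi p.2 (y i) - (q t).1 * phi (q t).2 (y i) =
      (y i.+1 - ce_inputs Q W y t i - (q t).1 * phi (q t).2 (y i)) -
      (y i.+1 - ce_inputs Q W y t i - p.1 * phi p.2 (y i)) by ring.
    by apply: le_trans (ler_normB _ _) _; rewrite mulr_natl mulr2n lerD.
  - move=> t; rewrite -phi_dist; [|exact: pos|exact: pos].
    rewrite loop lawE uE; apply: le_trans (ler_normD _ _) _.
    by rewrite lerD2l adm.
by exists M => _ [t _ <-].
Qed.

Lemma subcritical_locally_stabilizable (R : realType) (W a0 b0 : R) :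
  0 < W -> 0 < b0 -> b0 < 3 * Num.sqrt 3 / 2 ->
  locally_robustly_stabilizable W (a0, b0).
Proof.
move=> W0 b0_gt0 b0_lt.
have [e [e0 eb ec]] : exists e, [/\ 0 < e, e < b0 & b0 + e < 3 * Num.sqrt 3 / 2].
  exists (Num.min (b0 / 2) ((3 * Num.sqrt 3 / 2 - b0) / 2)).
  have m1 : Num.min (b0 / 2) ((3 * Num.sqrt 3 / 2 - b0) / 2) <= b0 / 2.
    by rewrite ge_min lexx.
  have m2 : Num.min (b0 / 2) ((3 * Num.sqrt 3 / 2 - b0) / 2) <=
    (3 * Num.sqrt 3 / 2 - b0) / 2 by rewrite ge_min lexx orbT.
  by split; [rewrite lt_min; apply/andP; split; lra|lra|lra].
exists (`[a0 - e, a0 + e]%classic `*` `[b0 - e, b0 + e]%classic); split.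
- by exists (a0 - e), (a0 + e), (b0 - e), (b0 + e); split=> //; lra.
- by move=> p [_ /=]; rewrite in_itv/= /param_space/= => /andP[h _]; lra.
- apply/nbhs_ballP; exists e => // p [/= p1 p2].
  by split; rewrite /= in_itv/=; [move: p1|move: p2];
    rewrite /ball/= ltr_norml => /andP[h1 h2]; apply/andP; split; lra.
- by apply: subcritical_rectangle_stabilizable; lra.
Qed.

(** * Supercritical exponents: the adversary *)

(** The intervals [v n - E n, v n + E n] are nested. *)
Lemma nested_intervals_point (R : realType) (v E : nat -> R) :
  (forall n, 0 <= E n) -> (forall n, `|v n.+1 - v n| <= E n - E n.+1) ->
  exists l, forall n, `|l - v n| <= E n.
Proof.
move=> E0 step.
have stepE n : v n - E n <= v n.+1 - E n.+1 /\ v n.+1 + E n.+1 <= v n + E n.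
  by have := step n; rewrite ler_norml => /andP[h1 h2]; split; lra.
have lo n k : v n - E n <= v (n + k)%N - E (n + k)%N.
  elim: k => [|k IH]; first by rewrite addn0.
  by rewrite addnS; apply: le_trans IH _; case: (stepE (n + k)%N).
have hi n k : v (n + k)%N + E (n + k)%N <= v n + E n.
  elim: k => [|k IH]; first by rewrite addn0.
  by rewrite addnS; apply: le_trans _ IH; case: (stepE (n + k)%N).
have cross n m : v n - E n <= v m + E m.
  have := lo n m; have := hi m n; rewrite [(m + n)%N]addnC.
  by have := E0 (n + m)%N; lra.
pose S := range (fun n => v n - E n).
have Sub m : ubound S (v m + E m) by move=> _ [n _ <-]; exact: cross.
exists (sup S) => n; rewrite ler_distl; apply/andP; split.
  by apply: ub_le_sup; [exists (v 0%N + E 0%N)|exists n].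
by apply: ge_sup => //; exists (v 0%N - E 0%N); exists 0%N.
Qed.

(** A parameter (s exp q.1, q.2) with |s| = 1 is represented by q, for which the
log-response q.1 + q.2 L is linear. *)
Definition response (R : realType) (s : R) (q : R * R) (y : R) : R :=
  s * expR q.1 * phi q.2 y.

Lemma response_dist (R : realType) (s : R) (q q' : R * R) (y : R) :
  `|s| = 1 -> y != 0 -> `|response s q y - response s q' y| =
  `|expR (q.1 + q.2 * ln `|y|) - expR (q'.1 + q'.2 * ln `|y|)|.
Proof.
move=> s1 y0; have powE b : `|y| `^ b = expR (b * ln `|y|).
  by rewrite /powR normr_eq0 (negbTE y0).
have responseE r : response s r y = s * Num.sg y * expR (r.1 + r.2 * ln `|y|).
  by rewrite /response /phi powE expRD; ring.
by rewrite !responseE -mulrBr !normrM s1 normr_sg y0 !mul1r.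
Qed.

Lemma expR_dist_ge (R : realType) (m x : R) : 0 <= x ->
  x * expR m <= `|expR (m + x) - expR (m - x)|.
Proof.
move=> x0; rewrite !expRD -mulrBr normrM (ger0_norm (expR_ge0 m)) mulrC.
rewrite ler_pM2l ?expR_gt0//; apply: le_trans (ler_norm _).
have := expR_ge1Dx x; have : expR (- x) <= 1 by rewrite expR_le1; lra.
lra.
Qed.

(** The log-response becomes q.1 + q.2 L + d (L - l): it turns around l. *)
Definition tilt (R : realType) (l d : R) (q : R * R) : R * R :=
  (q.1 - d * l, q.2 + d).

(** The scale ln |y_t| has index t + 2; two fictitious scales l0 and l1 precede
the initial state, so that the first two steps are like all others. *)
Definition log_scale (R : realType) (l0 l1 : R) (y : nat -> R) (n : nat) : R :=
  match n with 0 => l0 | 1 => l1 | t.+2 => ln `|y t| end.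

(** The size of the tilt at time t.  Tilting around the pivot lam (t + 1) by this
amount changes the log-response at any earlier scale by at most
k exp (- bp lam t), which is the precision with which it was observed at lam t,
and by much less than the precision at the scales before. *)
Definition freedom (R : realType) (k bp : R) (lam : nat -> R) (t : nat) : R :=
  k * expR (- (bp * lam t)) / lam t.+1.

Definition adversary_step (R : realType) (mu : feedback_law R)
    (s k bp l0 l1 : R) (t : nat) (st : (nat -> R) * (R * R)) :
    (nat -> R) * (R * R) :=
  let lam := log_scale l0 l1 st.1 in
  let d := freedom k bp lam t in
  let out e := response s (tilt (lam t.+1) (e * d) st.2) (st.1 t) +
               mu t (history st.1 t) in
  let e := if `|out 1| < `|out (-1)| then -1 else 1 in
  (fun i => if i == t.+1 then out e else st.1 i,
   tilt (lam t.+1) (e * d) st.2).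

Fixpoint adversary (R : realType) (mu : feedback_law R) (s k bp l0 l1 y0 : R)
    (q0 : R * R) (t : nat) : (nat -> R) * (R * R) :=
  if t is t'.+1 then
    adversary_step mu s k bp l0 l1 t' (adversary mu s k bp l0 l1 y0 q0 t')
  else (fun=> y0, q0).

Lemma log_scale_causal (R : realType) (l0 l1 : R) (y z : nat -> R) (n : nat) :
  (forall i, (i.+1 < n)%N -> y i = z i) ->
  log_scale l0 l1 y n = log_scale l0 l1 z n.
Proof. by case: n => [|[|n]]//= yz; rewrite yz. Qed.

(** The two candidate outputs differ by a quantity which does not depend on the
input; the larger of them is at least half of it. *)
Lemma adversary_run (R : realType) (mu : feedback_law R)
    (s k bp l0 l1 y0 : R) (q0 : R * R) :
  exists (y : nat -> R) (q : nat -> R * R), [/\ y 0%N = y0, q 0%N = q0 &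
    forall t, let lam := log_scale l0 l1 y in let d := freedom k bp lam t in
    exists e, [/\ `|e| = 1, q t.+1 = tilt (lam t.+1) (e * d) (q t),
      y t.+1 = response s (q t.+1) (y t) + mu t (history y t) &
      `|response s (tilt (lam t.+1) d (q t)) (y t) -
        response s (tilt (lam t.+1) (- d) (q t)) (y t)| <= 2 * `|y t.+1| ]].
Proof.
pose st := adversary mu s k bp l0 l1 y0 q0.
pose y t := (st t).1 t; pose q t := (st t).2.
have pathE t i : (i <= t)%N -> (st t).1 i = y i.
  elim: t i => [|t IH] i; first by rewrite leqn0 => /eqP ->.
  rewrite leq_eqVlt => /orP[/eqP -> //|]; rewrite ltnS => it.
  by rewrite -(IH i it) /st /= (ltn_eqF (_ : i < t.+1)%N).
exists y, q; split=> // t lam d.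
have histE : history (st t).1 t = history y t.
  by apply: eq_from_tnth => i; rewrite !tnth_mktuple pathE// -ltnS.
have lamE n : (n <= t.+1)%N -> log_scale l0 l1 (st t).1 n = lam n.
  move=> nt; apply: log_scale_causal => i in_; apply: pathE.
  by have := leq_trans in_ nt; rewrite ltnS => /ltnW.
pose out e := response s (tilt (lam t.+1) (e * d) (q t)) (y t) +
  mu t (history y t).
pose e : R := if `|out 1| < `|out (-1)| then -1 else 1.
have stE : st t.+1 = (fun i => if i == t.+1 then out e else (st t).1 i,
   tilt (lam t.+1) (e * d) (q t)).
  rewrite /st /= -/st /adversary_step /freedom !lamE// histE.
  by rewrite (pathE t t (leqnn t)).
have yE : y t.+1 = out e by rewrite /y stE /= eqxx.
exists e; split.
- by rewrite /e; case: ifP => _; rewrite ?normrN normr1.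
- by rewrite /q stE.
- by rewrite yE /out /q stE.
- have -> : response s (tilt (lam t.+1) d (q t)) (y t) -
      response s (tilt (lam t.+1) (- d) (q t)) (y t) = out 1 - out (-1).
    by rewrite /out mul1r mulN1r; ring.
  apply: le_trans (ler_normB _ _) _; rewrite yE /e.
  by case: ltP => h; rewrite mulr_natl mulr2n ?lerD// ltW.
Qed.

(** Let lam be the sequence of scales and D n = exp (- bp lam n).  As long as the
scales grow by the factor r = sqrt 3, D at least halves at each step; the
increments k D n of the parameter are then dominated by the differences of
2 k D n, and all errors telescope.

Growth: the two responses at time t differ by at least a multiple of
D t exp (q.1 + q.2 lam (t + 2)), so that
lam (t + 3) >= bm lam (t + 2) - bp lam t - C0 >= (bm - bp / 3) lam (t + 2) - C0,
and bm - bp / 3 > r makes the factor persist once the scales are at least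
L0.  Disturbance: the tilt following time t turns around lam (t + 2) itself and
does not affect the response at y_t; the later ones change the log-response
there by at most 4 k D (t + 2), hence the response by at most
4 k exp (al0 + eta) <= W. *)
Lemma adversary_wins (R : realType) (mu : feedback_law R)
    (s W al0 be0 eta : R) : 0 < W -> `|s| = 1 -> 0 < eta ->
  Num.sqrt 3 < (be0 - eta) - (be0 + eta) / 3 ->
  exists (q : R * R) (y : nat -> R),
    [/\ `|q.1 - al0| <= eta, `|q.2 - be0| <= eta,
      forall t, `|y t.+1 - (response s q (y t) + mu t (history y t))| <= W &
      forall M, exists t, M < `|y t|].
Proof.
move=> W0 s1 eta0 gap.
have r2 : Num.sqrt 3 * Num.sqrt 3 = 3 :> R by rewrite -expr2 sqr_sqrtr.
have r_ge0 := sqrtr_ge0 (3 : R).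
move: (Num.sqrt 3) r2 r_ge0 gap => r r2 r_ge0 gap.
have r_ge : 17 / 10 <= r by nra.
pose bp := be0 + eta; pose bm := be0 - eta.
have bp_ge : 17 / 10 <= bp by rewrite /bp; lra.
have bm_ge : 17 / 10 <= bm by rewrite /bm; rewrite /bp in bp_ge; lra.
pose A := expR (al0 + eta).
have A0 : 0 < A by exact: expR_gt0.
have [k [k0 keta kW]] : exists k, [/\ 0 < k, 2 * k <= eta & 4 * k * A <= W].
  exists (Num.min (eta / 2) (W / (4 * A))).
  have m1 : Num.min (eta / 2) (W / (4 * A)) <= eta / 2 by rewrite ge_min lexx.
  have m2 : Num.min (eta / 2) (W / (4 * A)) <= W / (4 * A).
    by rewrite ge_min lexx orbT.
  split; first by rewrite lt_min !divr_gt0// mulr_gt0.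
    by rewrite mulrC -ler_pdivlMr.
  by rewrite mulrAC mulrC -ler_pdivlMr// mulr_gt0.
pose g := bm - bp / 3 - r.
have g0 : 0 < g by rewrite /g /bm /bp; lra.
pose C0 := eta - al0 - ln (k / 4).
pose L0 := Num.max 1 (C0 / g).
have L0_ge1 : 1 <= L0 by rewrite le_max lexx.
have C0g : C0 <= g * L0.
  by rewrite mulrC -ler_pdivrMr// le_max lexx orbT.
have [y [q [y_0 q_0 run]]] :=
  adversary_run mu s k bp L0 (r * L0) (expR (3 * L0)) (al0, be0).
pose lam := log_scale L0 (r * L0) y.
pose D n := expR (- (bp * lam n)).
have D0 n : 0 < D n by exact: expR_gt0.
have lamE n : lam n.+2 = ln `|y n| by [].
clearbody L0.
have halve n : 1 <= lam n -> r * lam n <= lam n.+1 -> 2 * D n.+1 <= D n.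
  move=> lam1 lamr; rewrite /D.
  have -> : - (bp * lam n) = bp * (lam n.+1 - lam n) + - (bp * lam n.+1) by ring.
  rewrite expRD ler_pM2r ?expR_gt0//.
  apply: le_trans (expR_ge1Dx _).
  have : 7 / 10 <= lam n.+1 - lam n.
    by clear -lam1 lamr r_ge; nra.
  by move: (lam n.+1 - lam n) => z z_ge; clear -z_ge bp_ge; nra.
have {}run t : 1 <= lam t.+1 -> exists e d, [/\ `|e| = 1, 0 < d,
    d * lam t.+1 = k * D t, d <= k * D t & [/\
    q t.+1 = tilt (lam t.+1) (e * d) (q t),
    y t.+1 = response s (q t.+1) (y t) + mu t (history y t) &
    `|response s (tilt (lam t.+1) d (q t)) (y t) -
      response s (tilt (lam t.+1) (- d) (q t)) (y t)| <= 2 * `|y t.+1| ]].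
  move=> lam1; have [e [e1 qE yE spread]] := run t.
  have lam0 : 0 < lam t.+1 by exact: lt_le_trans lam1.
  pose d := freedom k bp lam t.
  have dE : d * lam t.+1 = k * D t.
    by rewrite /d /freedom -mulrA mulVf ?mulr1// gt_eqF.
  have d0 : 0 < d by rewrite /d /freedom !mulr_gt0 ?expR_gt0 ?invr_gt0.
  exists e, d; split=> //.
  by rewrite -dE ler_peMr// ltW.
have move_q t e d : `|e| = 1 -> 0 < d -> 1 <= lam t.+1 ->
    d * lam t.+1 = k * D t -> d <= k * D t -> 2 * D t.+1 <= D t ->
    q t.+1 = tilt (lam t.+1) (e * d) (q t) ->
    `|(q t.+1).1 - (q t).1| <= 2 * k * D t - 2 * k * D t.+1 /\
    `|(q t.+1).2 - (q t).2| <= 2 * k * D t - 2 * k * D t.+1.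
  move=> e1 d0 lam1 dE d_le Dt qE.
  have kD : k * D t <= 2 * k * D t - 2 * k * D t.+1.
    have : k * (2 * D t.+1) <= k * D t by rewrite ler_pM2l.
    by clear; lra.
  rewrite qE /tilt /=; split; apply: le_trans kD.
    rewrite addrAC subrr add0r normrN -mulrA normrM e1 mul1r dE.
    by rewrite ger0_norm// mulr_ge0 ?ltW.
  by rewrite addrAC subrr add0r normrM e1 mul1r gtr0_norm.
(* the bounds 2 k (1 - D t) leave room for the next increment, which is at most
   2 k (D t - D (t + 1)), and stay below eta *)
have inv t : [/\ L0 <= lam t, r * lam t <= lam t.+1,
    r * lam t.+1 <= lam t.+2, 0 < `|y t| &
    `|(q t).1 - al0| <= 2 * k * (1 - D t) /\
    `|(q t).2 - be0| <= 2 * k * (1 - D t)].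
  elim: t => [|t [IH0 IH1 IH2 yt [IHa IHb]]].
    have D1 : 0 <= 2 * k * (1 - D 0%N).
      rewrite !mulr_ge0 ?(ltW k0)// subr_ge0 expR_le1 oppr_le0 mulr_ge0//.
        by clear -bp_ge; lra.
      by rewrite /lam /=; clear -L0_ge1; lra.
    rewrite q_0 /= !subrr normr0; split=> //.
      rewrite /lam /= y_0 ger0_norm ?expR_ge0// expRK mulrA r2//.
    by rewrite y_0 normr_gt0 expR_eq0.
  have lam_ge1 : 1 <= lam t by exact: le_trans IH0.
  have lam1_ge1 : 1 <= lam t.+1.
    by clear -IH1 lam_ge1 r_ge; nra.
  have Dt := halve t lam_ge1 IH1.
  have [e [d [e1 d0 dE d_le [qE yE spread]]]] := run t lam1_ge1.
  have [qa qb] := move_q t e d e1 d0 lam1_ge1 dE d_le Dt qE.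
  have y0 : y t != 0 by rewrite -normr_gt0.
  pose L := lam t.+2; pose m := (q t).1 + (q t).2 * L.
  have Lge : 7 / 10 * lam t.+1 <= L - lam t.+1.
    by rewrite /L; move: (lam t.+2) IH2 => z; clear -r_ge lam1_ge1; nra.
  have L_ge1 : 1 <= L by move: Lge lam1_ge1; clear; lra.
  have x0 : 0 <= d * (L - lam t.+1).
    by rewrite mulr_ge0 ?(ltW d0)//; move: Lge lam1_ge1; clear; lra.
  have y_ge : k / 4 * D t * expR m <= `|y t.+1|.
    have xE : k / 4 * D t <= d * (L - lam t.+1) / 2.
      have : d * (7 / 10 * lam t.+1) <= d * (L - lam t.+1) by rewrite ler_pM2l.
      have -> : d * (7 / 10 * lam t.+1) = 7 / 10 * (d * lam t.+1) by ring.
      rewrite dE; have := mulr_gt0 k0 (D0 t).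
      by move: (d * _) => z; clear; lra.
    have := expR_dist_ge m x0; move: spread.
    rewrite response_dist// -lamE -/L /tilt /=.
    have -> : (q t).1 - d * lam t.+1 + ((q t).2 + d) * L =
      m + d * (L - lam t.+1) by rewrite /m; ring.
    have -> : (q t).1 - - d * lam t.+1 + ((q t).2 - d) * L =
      m - d * (L - lam t.+1) by rewrite /m; ring.
    move=> h1 h2; have := le_trans h2 h1.
    have := ler_wpM2r (expR_ge0 m) xE.
    by move: (d * _) (expR m) (D t) => z E D'; clear; lra.
  have y1 : 0 < `|y t.+1|.
    by apply: lt_le_trans y_ge; rewrite !mulr_gt0// expR_gt0.
  have kD1 : 2 * k * (1 - D t) <= eta.
    by apply: le_trans keta; rewrite ger_pMr ?mulr_gt0// gerBl ltW.
  have lam_small : lam t <= L / 3.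
    have : r * (r * lam t) <= r * lam t.+1 by rewrite ler_wpM2l.
    rewrite mulrA r2 => h; have := le_trans h IH2; rewrite -/L; clear; lra.
  have m_ge : al0 - eta + bm * L <= m.
    have h1 : al0 - eta <= (q t).1.
      by move: (le_trans IHa kD1); rewrite ler_distl => /andP[].
    have h2 : bm <= (q t).2.
      by move: (le_trans IHb kD1); rewrite ler_distl => /andP[].
    by rewrite lerD// ler_wpM2r// (le_trans _ L_ge1).
  split=> //.
  - by move: IH0 IH1 lam_ge1; clear -r_ge; nra.
  - move: y_ge; rewrite -/L -ler_ln ?posrE ?mulr_gt0 ?expR_gt0//.
    rewrite -lamE lnM ?posrE ?mulr_gt0 ?expR_gt0//.
    rewrite [ln (k / 4 * _)]lnM ?posrE ?divr_gt0 ?expR_gt0// !expRK.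
    have : bp * lam t <= bp * (L / 3).
      by rewrite ler_pM2l//; clear -bp_ge; lra.
    have : g * L0 <= g * L.
      rewrite ler_pM2l// (le_trans IH0)//; move: lam_small L_ge1; clear; lra.
    move: C0g m_ge; rewrite /C0 /g; clearbody bm bp L m.
    by move: (ln _) (lam t.+3) => lk z; clear; lra.
  - split.
      have -> : (q t.+1).1 - al0 = ((q t.+1).1 - (q t).1) + ((q t).1 - al0).
        by ring.
      by apply: le_trans (ler_normD _ _) _; move: qa IHa; clear; lra.
    have -> : (q t.+1).2 - be0 = ((q t.+1).2 - (q t).2) + ((q t).2 - be0).
      by ring.
    by apply: le_trans (ler_normD _ _) _; move: qb IHb; clear; lra.
have lam_ge1 n : 1 <= lam n by case: (inv n) => /(le_trans L0_ge1).
have lam_r n : r * lam n <= lam n.+1 by case: (inv n).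
have y_neq0 n : y n != 0 by rewrite -normr_gt0; case: (inv n).
have Dhalf n : 2 * D n.+1 <= D n by exact: halve.
have lam_step n : lam n + 7 / 10 <= lam n.+1.
  by have := lam_r n; have := lam_ge1 n; clear -r_ge; nra.
have lam_mono n j : lam n <= lam (n + j)%N.
  elim: j => [|j IH]; first by rewrite addn0.
  by rewrite addnS; have := lam_step (n + j)%N; move: IH; clear; lra.
have lam_large M : exists n, forall j, M < lam (n + j)%N.
  have lin n : n%:R * (7 / 10) <= lam n.
    elim: n => [|n IH]; first by rewrite mul0r (le_trans _ (lam_ge1 0%N)).
    by rewrite -natr1; have := lam_step n; move: IH; clear; lra.
  have [n Mn] := exists_nat_gt (M / (7 / 10)).
  exists n => j; apply: lt_le_trans (lam_mono n j).
  by apply: lt_le_trans (lin n); rewrite -ltr_pdivrMr// divr_gt0.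
have D_le n : D n * lam n <= 1.
  rewrite /D expRN mulrC ler_pdivrMr ?expR_gt0// mul1r.
  apply: le_trans (expR_ge1Dx _).
  by have := lam_ge1 n; clear -bp_ge; nra.
have q_step n : `|(q n.+1).1 - (q n).1| <= 2 * k * D n - 2 * k * D n.+1 /\
    `|(q n.+1).2 - (q n).2| <= 2 * k * D n - 2 * k * D n.+1.
  have [e [d [e1 d0 dE d_le [qE _ _]]]] := run n (lam_ge1 _).
  exact: (move_q n e d).
have kD0 n : 0 <= 2 * k * D n by rewrite !mulr_ge0// ltW.
have [al alP] : exists l, forall n, `|l - (q n).1| <= 2 * k * D n.
  by apply: nested_intervals_point => // n; case: (q_step n).
have [be beP] : exists l, forall n, `|l - (q n).2| <= 2 * k * D n.
  by apply: nested_intervals_point => // n; case: (q_step n).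
have kD_eta : 2 * k * D 0%N <= eta.
  apply: le_trans keta; rewrite ger_pMr ?mulr_gt0// expR_le1 oppr_le0.
  by rewrite mulr_ge0 ?(le_trans _ (lam_ge1 0%N))//; clear -bp_ge; lra.
have al_eta : `|al - al0| <= eta.
  by have := le_trans (alP 0%N) kD_eta; rewrite q_0.
have be_eta : `|be - be0| <= eta.
  by have := le_trans (beP 0%N) kD_eta; rewrite q_0.
exists (al, be), y; split=> //; last first.
  move=> M; have [n Hn] := lam_large (Num.max 0 M); exists n.
  have := Hn 2%N; rewrite addn2 lamE => h.
  apply: le_lt_trans (ln_sublinear _); last by rewrite normr_gt0.
  by apply: ltW; apply: le_lt_trans h; rewrite le_max lexx orbT.
move=> t; have [e [d [_ _ _ _ [_ yE _]]]] := run t (lam_ge1 _).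
rewrite [in y t.+1]yE opprD addrACA subrr addr0 response_dist// -lamE.
set L := lam t.+2.
have L0' : 0 <= L by exact: le_trans (lam_ge1 _).
pose ell n := (q n).1 + (q n).2 * L.
have pivot : ell t.+2 = ell t.+1.
  have [e' [d' [_ _ _ _ [qE _ _]]]] := run t.+1 (lam_ge1 _).
  by rewrite -/L in qE; rewrite /ell qE /tilt /=; ring.
have drift j : `|ell (t.+2 + j)%N - ell t.+1| <=
    2 * k * D t.+2 - 2 * k * D (t.+2 + j)%N.
  elim: j => [|j IH]; first by rewrite addn0 pivot !subrr normr0.
  rewrite addnS; set n := (t.+2 + j)%N in IH *.
  have [e' [d' [e1 d0 dE _ [qE _ _]]]] := run n (lam_ge1 _).
  have -> : ell n.+1 - ell t.+1 =
      (ell n - ell t.+1) + e' * (d' * (L - lam n.+1)).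
    by rewrite /ell qE /tilt /=; ring.
  apply: le_trans (ler_normD _ _) _.
  have : `|e' * (d' * (L - lam n.+1))| <= k * D n.
    rewrite normrM e1 mul1r normrM gtr0_norm// -dE ler_pM2l//.
    have := lam_mono t.+2 j.+1; rewrite addnS -/n -/L => Ln.
    by rewrite ler0_norm ?subr_le0// opprB gerBl.
  have : k * (2 * D n.+1) <= k * D n by rewrite ler_pM2l.
  by move: IH; move: (D n) (D n.+1) (D t.+2) => D1 D2 D3; clear; lra.
(* both coordinates of q n are within 2 k D n of the limit, and n is taken large
   enough for this error, amplified by 1 + L, to be below 2 k D (t + 2) *)
have near_limit : `|(al + be * L) - ell t.+1| <= 4 * k * D t.+2.
  have [n Hn] := lam_large ((1 + L) / D t.+2).
  have := Hn t.+2; rewrite addnC => {}Hn.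
  have Dn : D (t.+2 + n)%N * (1 + L) <= D t.+2.
    move: Hn; rewrite ltr_pdivrMr// => h.
    have := ler_wpM2l (ltW (D0 (t.+2 + n)%N)) (ltW h).
    have := ler_wpM2r (ltW (D0 t.+2)) (D_le (t.+2 + n)%N).
    by rewrite mul1r mulrA => h1 h2; exact: le_trans h2 h1.
  set n' := (t.+2 + n)%N in Dn *.
  have -> : al + be * L - ell t.+1 = (ell n' - ell t.+1) +
      ((al - (q n').1) + (be - (q n').2) * L) by rewrite /ell; ring.
  apply: le_trans (ler_normD _ _) _.
  have h1 := drift n.
  have h2 : `|(al - (q n').1) + (be - (q n').2) * L| <= 2 * k * (D n' * (1 + L)).
    apply: le_trans (ler_normD _ _) _; rewrite normrM (ger0_norm L0').
    rewrite mulrA mulrDr mulr1 lerD// ler_wpM2r//.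
  have h3 : k * (D n' * (1 + L)) <= k * D t.+2 by rewrite ler_pM2l.
  have := kD0 n'; move: h1 h2 h3; rewrite -/n'.
  by move: (D n' * (1 + L)) (D n') (D t.+2) => a b c; clear; lra.
have upper z z' : `|z - al0| <= eta -> `|z' - be0| <= eta ->
    expR (z + z' * L) <= A * expR (bp * L).
  rewrite !ler_distl => /andP[_ hz] /andP[_ hz'].
  by rewrite -expRD ler_expR lerD// ler_wpM2r.
have q_eta : `|(q t.+1).1 - al0| <= eta /\ `|(q t.+1).2 - be0| <= eta.
  have [_ _ _ _ [h1 h2]] := inv t.+1.
  have hD : 2 * k * (1 - D t.+1) <= eta.
    by apply: le_trans keta; rewrite ger_pMr ?mulr_gt0// gerBl ltW.
  by split; [exact: le_trans h1 hD|exact: le_trans h2 hD].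
have [qa qb] := q_eta.
apply: le_trans (dist_le_ln (expR_gt0 _) (expR_gt0 _) (upper _ _ qa qb)
  (upper _ _ al_eta be_eta)) _.
rewrite !expRK distrC.
have pos : 0 <= A * expR (bp * L) by rewrite mulr_ge0 ?expR_ge0// ltW.
apply: le_trans (ler_wpM2r pos near_limit) _.
have -> : 4 * k * D t.+2 * (A * expR (bp * L)) =
    4 * k * A * (D t.+2 * expR (bp * L)) by ring.
by rewrite /D -/L -expRD addNr expR0 mulr1.
Qed.

(** * The dichotomy *)

(** An interior point leaves room to move to b0 + e / 2, strictly above the
critical exponent, and to |a| = |a0| + e / 2, away from 0 where there would be
nothing to destabilize. *)
Lemma supercritical_rectangle (R : realType) (W a0 b0 : R) (Q : set (R * R)) :
  0 < W -> 3 * Num.sqrt 3 / 2 <= b0 -> interior Q (a0, b0) ->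
  ~ robustly_stabilizable W Q.
Proof.
move=> W0 b0_ge /nbhs_ballP[e /= e0 ballQ] [_ _ [mu stab]].
pose s : R := if 0 <= a0 then 1 else -1.
have s1 : `|s| = 1 by rewrite /s; case: ifP; rewrite ?normrN normr1.
have a0E : a0 = s * `|a0|.
  rewrite /s; have [a0_ge|a0_lt] := leP 0 a0; first by rewrite mul1r ger0_norm.
  by rewrite ltr0_norm// mulrNN mul1r.
pose c := `|a0| + e / 2.
have c0 : 0 < c by rewrite ltr_wpDl// divr_gt0.
pose B := c * expR 1.
have B0 : 0 < B by rewrite mulr_gt0 ?expR_gt0.
have [eta [eta0 eta_e eta1 etaB]] : exists eta,
    [/\ 0 < eta, eta <= e / 8, eta <= 1 & eta * B <= e / 4].
  exists (Num.min (Num.min (e / 8) 1) (e / 4 / B)).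
  split.
  - by rewrite !lt_min ltr01 !divr_gt0.
  - by rewrite !ge_min lexx.
  - by rewrite !ge_min lexx orbT.
  - by rewrite -ler_pdivlMr// !ge_min lexx orbT.
have gap : Num.sqrt 3 < (b0 + e / 2 - eta) - (b0 + e / 2 + eta) / 3 by lra.
have [q [y [qa qb fit unb]]] := adversary_wins mu (ln c) W0 s1 eta0 gap.
have Qq : Q (s * expR q.1, q.2).
  apply: ballQ; split; rewrite /ball /=.
    rewrite {1}a0E -mulrBr normrM s1 mul1r.
    have : `|expR q.1 - c| <= `|q.1 - ln c| * B.
      rewrite -{2}(expRK q.1); apply: dist_le_ln; rewrite ?expR_gt0//.
        rewrite /B -{1}(lnK c0) -expRD ler_expR.
        by move: qa; rewrite ler_distl => /andP[]; lra.
      by rewrite /B ler_peMr ?ltW// expR_gt1.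
    have : `|q.1 - ln c| * B <= eta * B by rewrite ler_pM2r.
    move=> h1 h2; have := le_trans h2 (le_trans h1 etaB).
    rewrite /c ler_norml => /andP[h3 h4].
    by rewrite ltr_norml; apply/andP; split; lra.
  move: qb; rewrite ler_norml => /andP[h3 h4].
  by rewrite ltr_norml; apply/andP; split; lra.
pose w n := if n is t.+1 then
  y t.+1 - (response s q (y t) + mu t (history y t)) else 0.
have adm : admissible_disturbance W w by case=> // t _; exact: fit.
have loop : closed_loop mu (s * expR q.1, q.2) w y.
  by move=> t; rewrite /w /response /= addrC subrK.
have [M HM] := stab _ _ _ Qq adm loop.
have [t Mt] := unb M.
by have := HM `|y t| (ex_intro2 _ _ t I erefl); rewrite leNgt Mt.
Qed.

Theorem corollary3p2 (R : realType) (W : R) (a0 b0 : R) (hW : 0 < W)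
    (hb0 : 0 < b0) :
  locally_robustly_stabilizable W (a0, b0) <-> b0 < 3 * Num.sqrt 3 / 2.
Proof.
split; last exact: subcritical_locally_stabilizable.
move=> [Q [_ _ intQ stab]]; rewrite ltNge; apply/negP => b0_ge.
exact: supercritical_rectangle intQ stab.
Qed.
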